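(* Let $\mathbb{P}$ be the set of prime numbers and let $\mathbb{P}-\mathbb{P}=\{p-q: p,q\in\mathbb{P}\}$. Suppose there exists $H\in\mathbb{N}$ such that $2h\in\mathbb{P}-\mathbb{P}$ for all integers $h\ge H$. Then there is no Borel probability measure $\mu$ on $\mathbb{R}$ such that $E(\mathbb{P})=\{e^{2\pi i p x}: p\in\mathbb{P}\}$ is an orthonormal basis for $L^2(\mu)$.
   Context: $L^2(\mu)$ is the complex Hilbert space of square-integrable complex-valued functions on $\mathbb{R}$ with inner product $\langle f,g\rangle=\int_{\mathbb{R}} f\overline{g}\,d\mu$. The family $E(\mathbb{P})$ is indexed by $\mathbb{P}$, with $e_p(x)=e^{2\pi i p x}$; ''orthonormal basis'' means that the family $(e_p)_{p\in\mathbb{P}}$ is orthonormal and has dense linear span in $L^2(\mu)$. $\mathbb{N}$ denotes the positive integers. *)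

(* Defs.v *)
From HB Require Import structures.
From mathcomp Require Import all_boot all_order all_algebra.
From mathcomp Require Import all_classical all_reals all_analysis.
From mathcomp Require Import complex.

Set Implicit Arguments.
Unset Strict Implicit.
Unset Printing Implicit Defensive.

Import Order.TTheory GRing.Theory Num.Theory.
Import numFieldNormedType.Exports.

Local Open Scope classical_set_scope.
Local Open Scope ring_scope.
Local Open Scope complex_scope.

Definition prime_diffs : set int :=
  [set z | exists p q : nat, [/\ prime p, prime q & z = p%:Z - q%:Z]].

Section ComplexL2.
Context {R : realType}.

(* [measurableTypeR R] is R with its Borel sigma-algebra. *)
Variable mu : {measure set (measurableTypeR R) -> \bar R}.

Definition cintegral (f : R -> R[i]) : R[i] :=
  Rintegral mu setT (fun x => complex.Re (f x)) +i*
  Rintegral mu setT (fun x => complex.Im (f x)).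

(* The elements of L^2 are given by representatives: functions equal
   mu-almost everywhere are at L2dist 0 and have the same inner products.
   Borel measurability into C = R^2 is that of both coordinates. *)
Definition L2 (f : R -> R[i]) : Prop :=
  [/\ measurable_fun setT (fun x : measurableTypeR R => complex.Re (f x)),
      measurable_fun setT (fun x : measurableTypeR R => complex.Im (f x)) &
      mu.-integrable setT
        (fun x : measurableTypeR R => (Normc.normc (f x) ^+ 2)%:E)].

Definition L2inner (f g : R -> R[i]) : R[i] :=
  cintegral (fun x => f x * (g x)^*).

Definition L2norm (f : R -> R[i]) : R := Num.sqrt (complex.Re (L2inner f f)).

Definition L2dist (f g : R -> R[i]) : R := L2norm (fun x => f x - g x).

Definition orthonormal_family (I : eqType) (e : I -> R -> R[i]) : Prop :=
  forall i j : I, L2inner (e i) (e j) = (i == j)%:R.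

Definition dense_linear_span (I : eqType) (e : I -> R -> R[i]) : Prop :=
  forall f : R -> R[i], L2 f -> forall eps : R, 0 < eps ->
  exists (s : seq I) (c : I -> R[i]),
    L2dist f (fun x => \sum_(i <- s) c i * e i x) < eps.

Definition orthonormal_basis (I : eqType) (e : I -> R -> R[i]) : Prop :=
  [/\ forall i : I, L2 (e i), orthonormal_family e & dense_linear_span e].

End ComplexL2.

(* e^(2 pi i lambda x), written by Euler's formula. *)
Definition expo {R : realType} (lambda x : R) : R[i] :=
  cos (2 * pi * lambda * x) +i* sin (2 * pi * lambda * x).

(* Main.v *)
(* Write m t for the integral of e^(2 pi i t x), so that <e_s, e_t> = m (s - t).
   By orthonormality m vanishes at every nonzero difference of primes, hence at
   all even integers of absolute value at least 2H.  Take n = 1 - 2H.  For an odd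
   prime p the integer p - n is even and at least 2H, so e_n is orthogonal to e_p;
   by completeness e_n is almost everywhere a multiple of e_2.  Thus e_(n-2) is
   almost everywhere a constant c, necessarily nonzero, and m (2 (n - 2)) = c^2,
   although 2 (n - 2) = -2 (2H + 1) is again an even integer at which m is 0. *)
Require Import Defs.
From mathcomp Require Import all_boot all_order all_algebra.
From mathcomp Require Import all_classical all_reals all_analysis.
From mathcomp Require Import complex measurable_realfun.
From mathcomp Require Import ring lra.

Import Order.TTheory GRing.Theory Num.Theory.

Local Open Scope classical_set_scope.
Local Open Scope ring_scope.

(** * Complex arithmetic in real and imaginary coordinates *)

Lemma conjcE {R : rcfType} (z : R[i]) : z^* = Complex (complex.Re z) (- complex.Im z).
Proof. by case: z. Qed.

Lemma ReM {R : rcfType} (z w : R[i]) : complex.Re (z * w) =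
  complex.Re z * complex.Re w - complex.Im z * complex.Im w.
Proof. by case: z w => a b [c d]. Qed.

Lemma ImM {R : rcfType} (z w : R[i]) : complex.Im (z * w) =
  complex.Re z * complex.Im w + complex.Im z * complex.Re w.
Proof. by case: z w => a b [c d]. Qed.

Lemma ReD {R : rcfType} (z w : R[i]) : complex.Re (z + w) = complex.Re z + complex.Re w.
Proof. by case: z w => a b [c d]. Qed.

Lemma ImD {R : rcfType} (z w : R[i]) : complex.Im (z + w) = complex.Im z + complex.Im w.
Proof. by case: z w => a b [c d]. Qed.

Lemma normc_sqr {R : rcfType} (z : R[i]) :
  Normc.normc z ^+ 2 = complex.Re z ^+ 2 + complex.Im z ^+ 2.
Proof. by case: z => a b /=; rewrite sqr_sqrtr// addr_ge0// sqr_ge0. Qed.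

Lemma ReMconj {R : rcfType} (z : R[i]) :
  complex.Re (z * z^*) = complex.Re z ^+ 2 + complex.Im z ^+ 2.
Proof. by rewrite ReM conjcE /= mulrN opprK !expr2. Qed.

(** With z = a + ib and w = c + id the left side is the absolute value of the real part of z times
    conj w. The factors 1 match the dominating function that [integrable_lincomb] provides. *)
Lemma norm_sum_mul_le {R : realDomainType} (a b c d : R) :
  `|a * c + b * d| <= 1 * (a ^+ 2 + b ^+ 2) + 1 * (c ^+ 2 + d ^+ 2).
Proof.
have := (sqr_ge0 (a + c), sqr_ge0 (a - c), sqr_ge0 (b + d), sqr_ge0 (b - d)).
have := (sqr_ge0 a, sqr_ge0 b, sqr_ge0 c, sqr_ge0 d).
by rewrite ler_norml => -[[[? ?] ?] ?] [[[? ?] ?] ?]; apply/andP; split; nra.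
Qed.

(** * Integration of complex functions and square integrability *)

Section ComplexIntegral.
Context {R : realType}.
Variable mu : {measure set (measurableTypeR R) -> \bar R}.
Implicit Types f g h : R -> R[i].

(** [Rintegral] is the [fine] of an extended integral, hence gives a default value when that is
    infinite; linearity of [cintegral] is therefore proved under this condition. *)
Definition cintegrable f : Prop :=
  mu.-integrable setT (EFin \o (fun x => complex.Re (f x))) /\
  mu.-integrable setT (EFin \o (fun x => complex.Im (f x))).

(** Multiplication by a complex constant mixes the two coordinates into combinations of this shape;
    the dominating functions below have it too. *)
Lemma integrable_lincomb (a b : R) (u v : measurableTypeR R -> R) :
  mu.-integrable setT (EFin \o u) -> mu.-integrable setT (EFin \o v) ->
  mu.-integrable setT (EFin \o (fun x => a * u x + b * v x)).
Proof.
move=> iu iv.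
by have := integrableD measurableT (integrableZl measurableT a iu)
  (integrableZl measurableT b iv).
Qed.

Lemma Rintegral_lincomb (a b : R) (u v : measurableTypeR R -> R) :
  mu.-integrable setT (EFin \o u) -> mu.-integrable setT (EFin \o v) ->
  Rintegral mu setT (fun x => a * u x + b * v x) =
  a * Rintegral mu setT u + b * Rintegral mu setT v.
Proof.
move=> iu iv.
have := RintegralD measurableT (integrableZl measurableT a iu)
  (integrableZl measurableT b iv).
by rewrite -(RintegralZl a measurableT iu) -(RintegralZl b measurableT iv).
Qed.

Lemma cintegralD f g : cintegrable f -> cintegrable g ->
  cintegral mu (fun x => f x + g x) = cintegral mu f + cintegral mu g.
Proof.
move=> [fr fi] [gr gi]; rewrite /cintegral.
under eq_Rintegral do rewrite ReD.
under [X in (_ +i* X)%C]eq_Rintegral do rewrite ImD.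
by rewrite !RintegralD.
Qed.

Lemma cintegralZl c f : cintegrable f ->
  cintegral mu (fun x => c * f x) = c * cintegral mu f.
Proof.
move=> [fr fi]; apply/eqP; rewrite eq_complex ReM ImM /=; apply/andP; split; apply/eqP.
- under eq_Rintegral do rewrite ReM -mulNr.
  by rewrite Rintegral_lincomb// mulNr.
- under eq_Rintegral do rewrite ImM.
  by rewrite Rintegral_lincomb.
Qed.

Lemma cintegral_conj f : cintegrable f ->
  cintegral mu (fun x => (f x)^*) = (cintegral mu f)^*.
Proof.
move=> [fr fi]; rewrite conjcE /cintegral /=.
under eq_Rintegral do rewrite conjcE /=.
under [X in (_ +i* X)%C]eq_Rintegral do rewrite conjcE /= -mulN1r.
by rewrite (RintegralZl (-1))// mulN1r.
Qed.

(** Replacing the squared modulus by a polynomial in the coordinates removes the square root, so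
    that domination reduces to polynomial inequalities. *)
Lemma L2P f : L2 mu f <->
  [/\ measurable_fun setT (fun x : measurableTypeR R => complex.Re (f x)),
      measurable_fun setT (fun x : measurableTypeR R => complex.Im (f x)) &
      mu.-integrable setT
        (EFin \o (fun x : measurableTypeR R =>
           complex.Re (f x) ^+ 2 + complex.Im (f x) ^+ 2))].
Proof.
have E : (fun x : measurableTypeR R => (Normc.normc (f x) ^+ 2)%:E) =
   (EFin \o (fun x : measurableTypeR R =>
           complex.Re (f x) ^+ 2 + complex.Im (f x) ^+ 2)).
  by apply/funext => x /=; rewrite normc_sqr.
by rewrite /L2 E.
Qed.

Lemma integrable_dominated (u v : measurableTypeR R -> R) : measurable_fun setT u ->
  (forall x, `|u x| <= v x) -> mu.-integrable setT (EFin \o v) ->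
  mu.-integrable setT (EFin \o u).
Proof.
move=> mu_ uv; apply: le_integrable => //.
  exact/measurable_EFinP.
by move=> x _ /=; rewrite lee_fin (le_trans (uv x)) ?ler_norm.
Qed.

(** Both coordinates of f conj(g) are bounded pointwise by |f|^2 + |g|^2. *)
Lemma L2_cintegrable f g : L2 mu f -> L2 mu g ->
  cintegrable (fun x => f x * (g x)^*).
Proof.
move=> /L2P[fr fi f2] /L2P[gr gi g2].
have fg2 := integrable_lincomb 1 1 _ _ f2 g2.
split; apply: integrable_dominated fg2.
- under eq_fun do rewrite ReM conjcE /= mulrN opprK.
  by apply: measurable_funD; apply: measurable_funM.
- move=> x; rewrite ReM conjcE /= mulrN opprK; exact: norm_sum_mul_le.
- under eq_fun do rewrite ImM conjcE /=.
  apply: measurable_funD; apply: measurable_funM => //.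
  exact: measurableT_comp.
(* The imaginary part pairs (Re f, Im f) with (- Im g, Re g), so the squares of g are swapped and
   one sign is inserted. *)
- move=> x; rewrite ImM conjcE /= (addrC (complex.Re (g x) ^+ 2)).
  rewrite -(sqrrN (complex.Im (g x))); exact: norm_sum_mul_le.
Qed.

Lemma L2D f g : L2 mu f -> L2 mu g -> L2 mu (fun x => f x + g x).
Proof.
move=> /L2P[fr fi f2] /L2P[gr gi g2]; apply/L2P.
have mr : measurable_fun setT (fun x : measurableTypeR R => complex.Re (f x + g x)).
  by under eq_fun do rewrite ReD; apply: measurable_funD.
have mi : measurable_fun setT (fun x : measurableTypeR R => complex.Im (f x + g x)).
  by under eq_fun do rewrite ImD; apply: measurable_funD.
(* The bound |f + g|^2 <= 2 |f|^2 + 2 |g|^2 holds because the two sides differ by |f - g|^2. *)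
split => //; apply: integrable_dominated (integrable_lincomb 2 2 _ _ f2 g2).
  by apply: measurable_funD; apply: measurable_funX.
move=> x; rewrite ger0_norm; last by rewrite addr_ge0// sqr_ge0.
rewrite ReD ImD.
have := sqr_ge0 (complex.Re (f x) - complex.Re (g x)).
have := sqr_ge0 (complex.Im (f x) - complex.Im (g x)).
nra.
Qed.

Lemma L2Zl c f : L2 mu f -> L2 mu (fun x => c * f x).
Proof.
move=> /L2P[fr fi f2]; apply/L2P; split.
- under eq_fun do rewrite ReM.
  by apply: measurable_funB; apply: measurable_funM.
- under eq_fun do rewrite ImM.
  by apply: measurable_funD; apply: measurable_funM.
(* Since |c f|^2 = |c|^2 |f|^2, the second summand of the combination gets coefficient 0. *)
- apply: (eq_integrable measurableT _ _ _ (integrable_lincomb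
    (complex.Re c ^+ 2 + complex.Im c ^+ 2) 0 _ _ f2 f2)).
  move=> x _ /=; rewrite ReM ImM; congr EFin; ring.
Qed.

Lemma L2_sum (I : Type) (s : seq I) (F : I -> R -> R[i]) :
  (forall i, L2 mu (F i)) -> L2 mu (fun x => \sum_(i <- s) F i x).
Proof.
move=> LF; elim: s => [|i s IH].
  under eq_fun do rewrite big_nil.
  apply/L2P; split; [exact: measurable_cst|exact: measurable_cst|].
  under eq_fun do rewrite /= expr0n /= addr0.
  exact: integrable0.
under eq_fun do rewrite big_cons.
exact: L2D.
Qed.

(** * The inner product, orthogonality and completeness *)

Lemma L2innerDl f g h : L2 mu f -> L2 mu g -> L2 mu h ->
  L2inner mu (fun x => f x + g x) h = L2inner mu f h + L2inner mu g h.
Proof.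
move=> Lf Lg Lh; rewrite /L2inner -cintegralD; try exact: L2_cintegrable.
by congr cintegral; apply/funext => x; rewrite mulrDl.
Qed.

Lemma L2innerZl c f h : L2 mu f -> L2 mu h ->
  L2inner mu (fun x => c * f x) h = c * L2inner mu f h.
Proof.
move=> Lf Lh; rewrite /L2inner -cintegralZl; try exact: L2_cintegrable.
by congr cintegral; apply/funext => x; rewrite mulrA.
Qed.

Lemma L2inner_conj f g : L2 mu f -> L2 mu g -> L2inner mu f g = (L2inner mu g f)^*.
Proof.
move=> Lf Lg; rewrite /L2inner -cintegral_conj; try exact: L2_cintegrable.
by congr cintegral; apply/funext => x; rewrite rmorphM/= conjCK mulrC.
Qed.

Lemma L2inner_sum_eq0 (I : Type) (s : seq I) (F : I -> R -> R[i]) h :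
  (forall i, L2 mu (F i)) -> L2 mu h -> (forall i, L2inner mu (F i) h = 0) ->
  L2inner mu (fun x => \sum_(i <- s) F i x) h = 0.
Proof.
move=> LF Lh F0; elim: s => [|i s IH].
  under eq_fun do rewrite big_nil.
  rewrite /L2inner /cintegral.
  under eq_Rintegral do rewrite mul0r /=.
  under [X in (_ +i* X)%C]eq_Rintegral do rewrite mul0r /=.
  by rewrite Rintegral_cst// mul0r.
under eq_fun do rewrite big_cons.
by rewrite L2innerDl ?F0 ?IH ?addr0//; apply: L2_sum.
Qed.

Lemma Re_L2inner_ge0 f : 0 <= complex.Re (L2inner mu f f).
Proof.
by apply: Rintegral_ge0 => x _; rewrite ReMconj addr_ge0// sqr_ge0.
Qed.

Lemma Re_L2inner_sub f g : L2 mu f -> L2 mu g -> L2inner mu g f = 0 ->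
  complex.Re (L2inner mu (fun x => f x - g x) (fun x => f x - g x)) =
  complex.Re (L2inner mu f f) + complex.Re (L2inner mu g g).
Proof.
move=> Lf Lg gf0.
have -> : (fun x => f x - g x) = (fun x => f x + -1 * g x).
  by apply/funext => x; rewrite mulN1r.
have LNg : L2 mu (fun x => -1 * g x) by exact: L2Zl.
have Lfg := L2D _ _ Lf LNg.
have fg0 : L2inner mu f g = 0 by rewrite L2inner_conj// gf0 conjC0.
(* Linearity is available in the first argument only; conjugate symmetry brings the second argument
   there. *)
rewrite L2innerDl// L2innerZl// (L2inner_conj f)// (L2inner_conj g)//.
rewrite !L2innerDl// !L2innerZl// gf0 fg0 mulr0 addr0 add0r.
rewrite ReD !mulN1r rmorphN opprK !conjcE; congr (_ + _); case: (L2inner mu g g).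
Qed.

(* Pythagoras: an approximant g of f in the span of e is orthogonal to f, so
   |f - g| >= |f|. *)
Lemma dense_orthogonal_eq0 {I : eqType} (e : I -> R -> R[i]) f :
  (forall i, L2 mu (e i)) -> dense_linear_span mu e -> L2 mu f ->
  (forall i, L2inner mu f (e i) = 0) -> complex.Re (L2inner mu f f) = 0.
Proof.
move=> Le de Lf fe0; apply/eqP; rewrite eq_le Re_L2inner_ge0 andbT leNgt.
apply/negP => f_gt0.
have sf : 0 < Num.sqrt (complex.Re (L2inner mu f f)) by rewrite sqrtr_gt0.
have [s [c]] := de f Lf _ sf.
apply/negP; rewrite -leNgt /L2dist /L2norm.
have Lce i : L2 mu (fun x => c i * e i x) by exact: L2Zl.
rewrite Re_L2inner_sub//.
- by rewrite ler_wsqrtr// lerDl Re_L2inner_ge0.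
- exact: L2_sum.
- apply: L2inner_sum_eq0 => // i.
  by rewrite L2innerZl// L2inner_conj// fe0 conjC0 mulr0.
Qed.

Lemma Re_L2inner_eq0_ae f : L2 mu f -> complex.Re (L2inner mu f f) = 0 ->
  {ae mu, forall x : measurableTypeR R, f x = 0}.
Proof.
move=> /L2P[fr fi f2]; rewrite /L2inner /cintegral /=.
under eq_Rintegral do rewrite ReMconj.
set u := fun x => _ => u0.
have iu0 : (\int[mu]_(x in setT) `|(EFin \o u) x| = 0)%E.
  (* An infinite integral would also have [fine] equal to 0; integrability of |f|^2 excludes
     this. *)
  rewrite -[RHS]/(0%:E) -u0 /Rintegral fineK; last exact: integrable_fin_num.
  by apply: eq_integral => x _; rewrite gee0_abs// lee_fin addr_ge0// sqr_ge0.
have mu_ : measurable_fun setT (EFin \o u) by case/integrableP: f2.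
have := (ae_eq_integral_abs mu measurableT mu_).1 iu0.
apply: filterS => x /(_ I) [] /eqP.
rewrite /u paddr_eq0 ?sqr_ge0// !sqrf_eq0 => /andP[/eqP r0 /eqP i0].
by apply/eqP; rewrite eq_complex r0 i0 !eqxx.
Qed.

End ComplexIntegral.

(** * Exponentials in L^2 of a probability measure *)

Section Exponentials.
Context {R : realType}.

Lemma expoD (s t x : R) : expo (s + t) x = expo s x * expo t x.
Proof.
apply/eqP; rewrite eq_complex ReM ImM /expo /=.
rewrite mulrDr mulrDl cosD sinD eqxx /=; apply/eqP; ring.
Qed.

Lemma expoN (s x : R) : expo (- s) x = (expo s x)^*.
Proof. by rewrite conjcE /expo /= mulrN mulNr cosN sinN. Qed.

Lemma expo0 (x : R) : expo 0 x = 1.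
Proof. by rewrite /expo mulr0 mul0r cos0 sin0. Qed.

Lemma measurable_Re_expo (s : R) :
  measurable_fun setT (fun x : measurableTypeR R => complex.Re (expo s x)).
Proof.
apply: (@measurableT_comp _ _ _ _ _ _ cos).
  by apply: continuous_measurable_fun; exact: continuous_cos.
exact: measurable_funM.
Qed.

Lemma measurable_Im_expo (s : R) :
  measurable_fun setT (fun x : measurableTypeR R => complex.Im (expo s x)).
Proof.
apply: (@measurableT_comp _ _ _ _ _ _ sin).
  by apply: continuous_measurable_fun; exact: continuous_sin.
exact: measurable_funM.
Qed.

Variable mu : probability (measurableTypeR R) R.

Lemma L2_expo (s : R) : L2 mu (expo s).
Proof.
apply/L2P; split; [exact: measurable_Re_expo|exact: measurable_Im_expo|].
under eq_fun do rewrite /= cos2Dsin2.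
exact: finite_measure_integrable_cst.
Qed.

Lemma L2inner_expo (s t : R) :
  L2inner mu (expo s) (expo t) = cintegral mu (expo (s - t)).
Proof. by congr cintegral; apply/funext => x; rewrite expoD expoN. Qed.

Lemma Rintegral_ae_cst (u : measurableTypeR R -> R) (c : R) :
  measurable_fun setT u -> {ae mu, forall x, u x = c} -> Rintegral mu setT u = c.
Proof.
move=> mu_ uc.
transitivity (Rintegral mu setT (fun=> c)).
  congr fine; apply: ae_eq_integral => //; first exact/measurable_EFinP.
  by apply: filterS uc => x -> _.
by rewrite Rintegral_cst//= probability_setT mulr1.
Qed.

Lemma cintegral_expo_ae_cst (s : R) (c : R[i]) :
  {ae mu, forall x : measurableTypeR R, expo s x = c} -> cintegral mu (expo s) = c.
Proof.
move=> sc; rewrite /cintegral.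
rewrite (Rintegral_ae_cst _ (complex.Re c)) ?(Rintegral_ae_cst _ (complex.Im c)).
- by case: c {sc}.
- exact: measurable_Im_expo.
- by apply: filterS sc => x ->.
- exact: measurable_Re_expo.
- by apply: filterS sc => x ->.
Qed.

(** Almost everywhere e_(2s) = e_s^2 = c^2, so the integral is c^2. If c were 0, then e_0 = e_s
    e_(-s) would vanish almost everywhere, although it is 1 and the total mass is 1. *)
Lemma cintegral_expo_2M_neq0 (s : R) (c : R[i]) :
  {ae mu, forall x : measurableTypeR R, expo s x = c} -> cintegral mu (expo (2 * s)) != 0.
Proof.
move=> sc; apply/eqP.
rewrite (cintegral_expo_ae_cst _ (c * c)); last first.
  by apply: filterS sc => x sx; rewrite mulr_natl mulr2n expoD sx.
move=> /eqP; rewrite mulf_eq0 orbb => /eqP c0.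
have e0 : cintegral mu (expo 0) = 0.
  apply: cintegral_expo_ae_cst; apply: filterS sc => x.
  by rewrite -(subrr s) expoD c0 => ->; rewrite mul0r.
have e1 : cintegral mu (expo 0) = 1.
  by apply: cintegral_expo_ae_cst; apply/aeW => x; rewrite expo0.
by have := oner_neq0 R[i]; rewrite -e1 e0 eqxx.
Qed.

(** Subtract from e_s its projection onto the i-th basis vector. The remainder is orthogonal to the
    whole basis, so it vanishes almost everywhere; multiplying by the inverse exponential isolates
    the constant. *)
Lemma expo_ae_proportional {I : eqType} (e : I -> R) (i : I) (s : R) :
  orthonormal_basis mu (fun j => expo (e j)) ->
  (forall j, j != i -> cintegral mu (expo (s - e j)) = 0) ->
  {ae mu, forall x : measurableTypeR R, expo (s - e i) x = cintegral mu (expo (s - e i))}.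
Proof.
move=> [Le on de] s0; set a := cintegral mu _.
pose f x := expo s x + (- a) * expo (e i) x.
have Lg : L2 mu (fun x => - a * expo (e i) x) by apply: L2Zl; exact: L2_expo.
have Lf : L2 mu f by apply: L2D => //; exact: L2_expo.
have fe0 j : L2inner mu f (expo (e j)) = 0.
  rewrite L2innerDl ?L2innerZl ?on//; try exact: L2_expo.
  rewrite L2inner_expo; have [<-|ij] := eqVneq i j; first by rewrite mulr1 subrr.
  by rewrite s0 1?eq_sym// mulr0 addr0.
apply: filterS (Re_L2inner_eq0_ae mu f Lf (dense_orthogonal_eq0 mu _ f Le de Lf fe0)).
move=> x /eqP; rewrite /f mulNr subr_eq0 => /eqP sx.
by rewrite expoD sx -mulrA -expoD subrr expo0 mulr1.
Qed.

(** For z = p - q the integral is the inner product of e_q with e_p, and z != 0 forces p and q to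
    differ. The sign is chosen because the main argument meets negative frequencies only. *)
Lemma cintegral_expo_prime_diffs (z : int) : z != 0 -> prime_diffs z ->
  orthonormal_family mu (fun p : {p : nat | prime p} => expo (val p)%:R) ->
  cintegral mu (expo (- z%:~R)) = 0.
Proof.
move=> z0 [p [q [pp pq zE]]] on.
have := on (exist _ q pq) (exist _ p pp); rewrite L2inner_expo /=.
have -> : - (z%:~R : R) = q%:R - p%:R by rewrite zE rmorphB/= opprB.
move=> ->; case: eqP => // -[qp].
by move: z0; rewrite zE qp subrr eqxx.
Qed.

End Exponentials.

(** * The contradiction for prime frequencies *)

Theorem theorem1p5 (R : realType)
  (hyp : exists H : nat, (0 < H)%N /\
     forall h : int, H%:Z <= h -> prime_diffs (2 * h)) :
  ~ exists mu : probability (measurableTypeR R) R,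
      orthonormal_basis mu (fun p : {p : nat | prime p} => expo (val p)%:R).
Proof.
move: hyp => [H [H_gt0 diffs]] [mu onb].
have even0 (h : nat) : (H <= h)%N -> cintegral mu (expo (- (2 * h%:R))) = 0.
  move=> Hh; have -> : - (2 * h%:R) = - ((2 * h%:Z)%:~R) :> R.
    by rewrite intrM.
  apply: cintegral_expo_prime_diffs.
  (* Positivity of H makes 2h nonzero. *)
  - by rewrite mulf_neq0// eqz_nat -lt0n (leq_trans H_gt0).
  - exact: diffs.
  - by case: onb.
pose two : {p : nat | prime p} := exist _ 2%N isT.
have odd0 (p : {p : nat | prime p}) : p != two ->
    cintegral mu (expo (1 - 2 * H%:R - (val p)%:R)) = 0.
  case: p => p pp /eqP p2 /=.
  have [p_eq2|p_odd] := even_prime pp.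
    by case: p2; apply: val_inj.
  (* Writing p = 2k + 1 with k = [p./2] gives 1 - 2H - p = -2 (H + k). *)
  rewrite -(even0 (H + p./2)%N) ?leq_addr//; congr (cintegral mu (expo _)).
  rewrite -{1}(odd_double_half p) p_odd natrD -mul2n natrM natrD mulr1n; ring.
have ae_cst := expo_ae_proportional mu (fun p : {p : nat | prime p} => (val p)%:R)
  two _ onb odd0.
have /eqP := cintegral_expo_2M_neq0 mu _ _ ae_cst; apply.
(* Here s = 1 - 2H - 2 = -(2H + 1), so 2s = -2h with h = 2H + 1 >= H. *)
rewrite -[RHS](even0 (2 * H).+1) ?leqW ?leq_pmull//; congr (cintegral mu (expo _)).
rewrite /= -(addn1 (2 * H)) natrD natrM; ring.
Qed.
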